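(* Let $\alpha$ be an irrational number of finite Diophantine type $\gamma(\alpha)<+\infty$ and let $R_\alpha:\mathbb{S}^1\to\mathbb{S}^1$, $R_\alpha(x)=x+\alpha\pmod{\mathbb{Z}}$. Let $\overline{\delta}>0$ and let $\{T_\delta\}_{0\le\delta\le\overline{\delta}}$ be a family of Borel measurable maps $T_\delta:\mathbb{S}^1\to\mathbb{S}^1$ such that $$\sup_{x\in\mathbb{S}^1}|R_\alpha(x)-T_\delta(x)|\le\delta .$$ Suppose that, for each $\delta$, $\mu_\delta$ is an invariant Borel probability measure of $T_\delta$. Then for each $\ell<\frac{1}{\gamma(\alpha)+1}$, $$\|m-\mu_\delta\|_W=O(\delta^{\ell})\qquad\text{as }\delta\to0 .$$
   Context: $\mathbb{S}^1=\mathbb{R}/\mathbb{Z}$, $|x-y|$ denotes the circle distance between $x,y\in\mathbb{S}^1$, and $m$ is Lebesgue (probability) measure on $\mathbb{S}^1$. A measure $\mu$ is invariant for a Borel map $T$ if $\mu(T^{-1}(A))=\mu(A)$ for all Borel sets $A$. For a finite signed Borel measure $\mu$ on $\mathbb{S}^1$, $$\|\mu\|_W:=\sup\left\{\left|\int_{\mathbb{S}^1} g\,d\mu\right| : g:\mathbb{S}^1\to\mathbb{R},\ \mathrm{Lip}(g)\le1,\ \|g\|_\infty\le1\right\},$$ where $\mathrm{Lip}(g)$ is the best Lipschitz constant of $g$. With $\|\cdot\|_{\mathbb{Z}}$ the distance to the nearest integer, the Diophantine type of an irrational $\alpha$ is $$\gamma(\alpha):=\sup\{\gamma\ge0:\ \liminf_{k\to\infty}k^{\gamma}\|k\alpha\|_{\mathbb{Z}}=0\}\in[0,+\infty].$$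 *)

(* Defs.v *)
From HB Require Import structures.
From mathcomp Require Import all_boot all_order all_algebra.
From mathcomp Require Import all_classical all_reals all_analysis.

Set Implicit Arguments.
Unset Strict Implicit.
Unset Printing Implicit Defensive.

Import Order.TTheory GRing.Theory Num.Theory.
Import numFieldNormedType.Exports.

Local Open Scope classical_set_scope.
Local Open Scope ring_scope.
Local Open Scope quotient_scope.

Section integers.
Context {R : realType}.

Definition Zpred : {pred R} := fun x => x \is a Num.int.

Lemma Zpred_zmod_closed : zmod_closed Zpred.
Proof. by split=> [|x y]; [exact: rpred0 | exact: rpredB]. Qed.

HB.instance Definition _ := GRing.isZmodClosed.Build R Zpred Zpred_zmod_closed.

End integers.

(* [{ideal_quot _}] only uses the additive structure here: this is the quotient
   group R/Z, equipped with the quotient topology. *)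
Definition circle (R : realType) : Type :=
  quotient_topology {ideal_quot (@Zpred R)}.

Section circle_structures.
Context {R : realType}.

HB.instance Definition _ := PointedTopological.on (circle R).
HB.instance Definition _ :=
  GRing.Zmodule.copy (circle R) {ideal_quot (@Zpred R)}.
HB.instance Definition _ := Quotient.on (circle R).
(* Borel sigma-algebra, generated by the open sets. *)
HB.instance Definition _ :=
  Measurable.copy (circle R) (g_sigma_algebraType (@open (circle R))).

Definition to_circle (x : measurableTypeR R) : circle R := \pi_(circle R) x.

Lemma measurable_to_circle : measurable_fun [set: measurableTypeR R] to_circle.
Proof.
apply: measurability => //.
move=> _ [U oU <-]; rewrite setTI; apply: measurable_realfun.open_measurable.
by move/continuousP: (@pi_continuous R {ideal_quot (@Zpred R)}); apply.
Qed.

HB.instance Definition _ :=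
  isMeasurableFun.Build _ _ _ _ to_circle measurable_to_circle.

End circle_structures.

(* Lebesgue probability measure of the circle: the image of the Lebesgue
   measure of [0, 1] under the projection. *)
Definition circle_leb (R : realType) : probability (circle R) R :=
  distribution (uniform_prob (@ltr01 R))
    (@to_circle R).

Section definitions.
Context {R : realType}.
Implicit Types (x y : circle R) (g : circle R -> R) (a : R).

(* distance to the nearest integer *)
Definition dist_int a : R := inf [set `|a - n%:~R| | n in [set: int]].

(* [dist_int] is 1-periodic, hence the choice of representative is
   irrelevant. *)
Definition circle_dist x y : R := dist_int (repr (x - y)).

Definition rotation a x : circle R := x + to_circle a.

Definition dioph_type a : \bar R :=
  ereal_sup [set gamma%:E | gamma in [set gamma : R | 0 <= gamma /\
    limn_einf (fun k : nat => (k%:R `^ gamma * dist_int (k%:R * a))%:E) = 0%E]].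

(* best Lipschitz constant, +oo if g is not Lipschitz *)
Definition lip_const g : \bar R :=
  ereal_inf [set L%:E | L in [set L : R | 0 <= L /\
    forall x y, `|g x - g y| <= L * circle_dist x y]].

Definition sup_norm g : \bar R :=
  ereal_sup [set `|g x|%:E | x in [set: circle R]].

Definition invariant_measure (T : circle R -> circle R)
    (mu : {measure set (circle R) -> \bar R}) : Prop :=
  forall A, measurable A -> mu (T @^-1` A) = mu A.

End definitions.

(* The integral with respect to a charge nu is the difference of the integrals
   with respect to the positive and negative parts of its Jordan
   decomposition, which do not depend on the choice of a Hahn decomposition. *)
Section charge_integral.
Context d (T : measurableType d) (R : realType).
Variable nu : {charge set T -> \bar R}.

Definition hahn_pos : set T := sval (cid (Hahn_decomposition nu)).

Definition hahn_neg : set T := sval (cid (svalP (cid (Hahn_decomposition nu)))).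

Lemma hahn_posneg : hahn_decomposition nu hahn_pos hahn_neg.
Proof. exact: svalP (cid (svalP (cid (Hahn_decomposition nu)))). Qed.

Definition charge_integral (g : T -> R) : R :=
  Rintegral (jordan_pos hahn_posneg) setT g -
  Rintegral (jordan_neg hahn_posneg) setT g.

End charge_integral.

(* The set below contains 0 and is bounded by the total variation of nu. *)
Definition norm_W (R : realType) (nu : {charge set (circle R) -> \bar R}) : R :=
  sup [set `|charge_integral nu g| | g in [set g : circle R -> R |
    (lip_const g <= 1)%E /\ (sup_norm g <= 1)%E]].

Definition measure_diff d (T : measurableType d) (R : realType)
    (mu1 mu2 : {finite_measure set T -> \bar R}) : {charge set T -> \bar R} :=
  cadd (charge_of_finite_measure mu1) (copp (charge_of_finite_measure mu2)).

(* Main.v *)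
(* By invariance, [q * \int g d mu] is the integral of the Birkhoff sum of [g] over
   [q] steps of [T delta], which differs from the sum over [q] steps of the
   rotation by [O(q^2 delta)]. If [p / q] is a reduced fraction with
   [|q alpha - p| <= 1 / Q] and [q <= Q], the latter sum is [O(1)]-close to the sum
   along the rotation by [p / q], which is [1 / q]-periodic, so that it oscillates
   by [O(1)] only. Since Lebesgue measure is invariant under the rotation, the same
   comparison applies to it, and the two integrals differ by [O(1 / q + q delta)].
   The Diophantine condition with exponent [gamma] forces [q >= (c Q)^(1 / gamma)]
   for the [q] given by Dirichlet's theorem, and [Q ~ delta^(- gamma / (gamma + 1))]
   balances the two terms. *)
From HB Require Import structures.
Require Import Defs.
From mathcomp Require Import all_boot all_order all_algebra.
From mathcomp Require Import all_classical all_reals all_analysis.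
From mathcomp Require Import measurable_realfun.
From mathcomp Require Import ring lra zify.
Import Order.TTheory GRing.Theory Num.Theory.
Import numFieldNormedType.Exports.
Local Open Scope classical_set_scope.
Local Open Scope ring_scope.

(** * The projection from the reals to the circle as a group morphism *)

Section circle_group.
Local Open Scope quotient_scope.
Context {R : realType}.
Implicit Types (a b s t : R) (x y z : circle R).

Lemma to_circleD s t : to_circle (s + t) = to_circle s + to_circle t :> circle R.
Proof. exact: (@Quotient.pi_add R (@Zpred R)). Qed.

Lemma to_circleN s : to_circle (- s) = - to_circle s :> circle R.
Proof. exact: (@Quotient.pi_opp R (@Zpred R)). Qed.

Lemma to_circle_eq s t :
  to_circle s = to_circle t :> circle R <-> s - t \is a Num.int.
Proof.
have h : (s - t \is a Num.int) =
    (s == t %[mod {ideal_quot (@Zpred R)}]).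
  exact: (@Quotient.idealrBE R (@Zpred R)).
by rewrite h; case: (@eqP {ideal_quot (@Zpred R)}).
Qed.

Lemma to_circle0 : to_circle 0 = 0 :> circle R.
Proof. by rewrite -[in LHS](subrr 0) to_circleD to_circleN subrr. Qed.

Lemma to_circle_int (n : int) : to_circle n%:~R = 0 :> circle R.
Proof. by rewrite -to_circle0; apply/to_circle_eq; rewrite subr0 intr_int. Qed.

Lemma to_circleMn s n : to_circle (n%:R * s) = to_circle s *+ n :> circle R.
Proof.
elim: n => [|n ih]; first by rewrite mul0r to_circle0.
by rewrite mulrS mulrDl mul1r to_circleD ih mulrS.
Qed.

Lemma to_circle_repr x : to_circle (repr x) = x.
Proof. exact: reprK. Qed.

End circle_group.

(** * Distance to the nearest integer and the circle distance *)

Section circle_distance.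
Context {R : realType}.
Implicit Types (a b s t : R) (x y z : circle R).

Lemma dist_int_has_inf a : has_inf [set `|a - n%:~R| | n in [set: int]].
Proof.
split; first by exists `|a - 0%:~R|; exists 0.
by exists 0 => _ [n _ <-].
Qed.

Lemma dist_int_le a (n : int) : dist_int a <= `|a - n%:~R|.
Proof. by apply: ge_inf; [exact: (dist_int_has_inf a).2|exists n]. Qed.

Lemma le_dist_int a e : (forall n : int, e <= `|a - n%:~R|) -> e <= dist_int a.
Proof.
move=> h; apply: lb_le_inf; first exact: (dist_int_has_inf a).1.
by move=> _ [n _ <-].
Qed.

Lemma dist_int_ge0 a : 0 <= dist_int a.
Proof. exact: le_dist_int. Qed.

Lemma dist_int_le_norm a : dist_int a <= `|a|.
Proof. by have := dist_int_le a 0; rewrite subr0. Qed.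

Lemma dist_int_le1 a : dist_int a <= 1.
Proof.
apply: (le_trans (dist_int_le a (Num.floor a))).
have := Num.Theory.floor_itv a; rewrite intrD => /andP[h1 h2].
by rewrite ler_norml; apply/andP; split; lra.
Qed.

Lemma dist_intDr_le a (n : int) : dist_int a <= dist_int (a + n%:~R).
Proof.
apply: le_dist_int => m; apply: (le_trans (dist_int_le a (m - n))).
by rewrite intrD mulrNz opprD opprK addrA addrAC.
Qed.

Lemma dist_intDr a (n : int) : dist_int (a + n%:~R) = dist_int a.
Proof.
apply/eqP; rewrite eq_le dist_intDr_le andbT.
by apply: (le_trans (dist_intDr_le _ (- n))); rewrite mulrNz addrK.
Qed.

Lemma dist_intD a b : dist_int (a + b) <= dist_int a + dist_int b.
Proof.
rewrite -lerBlDr; apply: le_dist_int => m.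
rewrite lerBlDr -lerBlDl; apply: le_dist_int => n.
rewrite lerBlDl; apply: (le_trans (dist_int_le _ (m + n))).
by rewrite intrD opprD addrACA; exact: ler_normD.
Qed.

(** This removes the choice of [repr]: two real lifts of [x - y] differ by an integer, which
    [dist_int] does not see. *)
Lemma circle_dist_to_circle x y t : x - y = to_circle t ->
  circle_dist x y = dist_int t.
Proof.
rewrite /circle_dist => ->.
have /to_circle_eq/intrP[n hn] := to_circle_repr (to_circle t).
by rewrite -[repr _](subrK t) hn addrC dist_intDr.
Qed.

Lemma circle_dist_ge0 x y : 0 <= circle_dist x y.
Proof. exact: dist_int_ge0. Qed.

Lemma circle_dist_le1 x y : circle_dist x y <= 1.
Proof. exact: dist_int_le1. Qed.

Lemma circle_distxx x : circle_dist x x = 0.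
Proof.
rewrite (@circle_dist_to_circle x x 0) ?subrr ?to_circle0//.
have := dist_int_le_norm (0 : R); rewrite normr0 => d0.
by apply/le_anti; rewrite d0 dist_int_ge0.
Qed.

Lemma circle_dist_triangle y x z :
  circle_dist x z <= circle_dist x y + circle_dist y z.
Proof.
rewrite (_ : circle_dist x z = dist_int (repr (x - y) + repr (y - z))).
  exact: dist_intD.
by apply: circle_dist_to_circle; rewrite to_circleD !to_circle_repr addrA subrK.
Qed.

Lemma circle_distDr x y z : circle_dist (x + z) (y + z) = circle_dist x y.
Proof. by rewrite /circle_dist opprD addrACA subrr addr0. Qed.

Lemma circle_dist_to_circle_le x s t :
  circle_dist (x + to_circle s) (x + to_circle t) <= `|s - t|.
Proof.
rewrite (@circle_dist_to_circle _ _ (s - t)) ?dist_int_le_norm//.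
by rewrite to_circleD to_circleN opprD addrACA subrr add0r.
Qed.

End circle_distance.

(** * Rational approximation and the Diophantine type *)

Section diophantine_approximation.
Context {R : realType}.
Implicit Types a b : R.

(** Every integer is at least as far from [b] as one of the two neighbours, the floor and the floor
    plus one, and a non-integer lies at positive distance from both. *)
Lemma dist_int_gt0 b : b \isn't a Num.int -> 0 < dist_int b.
Proof.
move=> bI; have /andP[h1 h2] := Num.Theory.floor_itv b.
have h1' : (Num.floor b)%:~R < b.
  rewrite lt_neqAle h1 andbT; apply: contra bI => /eqP <-; exact: intr_int.
apply: (@lt_le_trans _ _ (Num.min (b - (Num.floor b)%:~R)
   ((Num.floor b + 1)%:~R - b))).
  by rewrite lt_min !subr_gt0 h1' h2.
apply: le_dist_int => n; rewrite ge_min.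
have [nb|nb] := leP n (Num.floor b).
  apply/orP; left; apply: le_trans (ler_norm _).
  by rewrite lerD2l lerN2 ler_int.
apply/orP; right; rewrite distrC; apply: le_trans (ler_norm _).
by rewrite lerD2r ler_int; lia.
Qed.

Lemma dist_int_irrational_gt0 a (k : nat) :
  irrational a -> (0 < k)%N -> 0 < dist_int (k%:R * a).
Proof.
move=> airr k0; apply: dist_int_gt0; apply/negP => /intrP[n hn].
apply: airr; apply/rationalP; exists n, k.
by rewrite -hn mulrC mulKf// pnatr_eq0 -lt0n.
Qed.

(** Pigeonhole: the [Q + 1] fractional parts of [i * a] fall into [Q] boxes of length [1 / Q], so
    two of them share a box; [q] is the difference of their indices. *)
Lemma dirichlet_approximation a (Q : nat) : (0 < Q)%N ->
  exists (q : nat) (p : int),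
    (0 < q <= Q)%N /\ `|q%:R * a - p%:~R| <= Q%:R^-1.
Proof.
move=> Q0; have Q0' : 0 < Q%:R :> R by rewrite ltr0n.
pose fr (i : nat) : R := i%:R * a - (Num.floor (i%:R * a))%:~R.
have fr_itv i : 0 <= fr i < 1.
  have := Num.Theory.floor_itv (i%:R * a).
  by rewrite intrD /fr => /andP[h1 h2]; apply/andP; split; lra.
have frQ i : (Num.truncn (Q%:R * fr i) < Q)%N.
  have /andP[h1 h2] := fr_itv i.
  by rewrite Num.Theory.truncn_lt_nat ?mulr_ge0 ?ler0n// gtr_pMr.
pose f (i : 'I_Q.+1) : 'I_Q := Ordinal (frQ i).
have /injectivePn[i0 [j0 ij0 fij0]] : ~~ injectiveb f.
  by apply/negP => /injectiveP/leq_card; rewrite !card_ord ltnn.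
have [i [j [ij fij]]] : exists i j : 'I_Q.+1, (i < j)%N /\ f i = f j.
  case: (ltngtP i0 j0) => h; [by exists i0, j0|by exists j0, i0|].
  by move/eqP: ij0; case; exact/val_inj.
exists (j - i)%N, (Num.floor (j%:R * a) - Num.floor (i%:R * a)).
split; first by have := ltn_ord j; lia.
have trE k : (f k)%:R <= Q%:R * fr k < (f k).+1%:R.
  apply: Num.Theory.truncn_itv; rewrite mulr_ge0//.
  by have /andP[] := fr_itv k.
rewrite (_ : _ - _ = fr j - fr i); last first.
  by rewrite natrB ?(ltnW ij)// intrB /fr; ring.
have /andP[i1 i2] := trE i; have /andP[j1 j2] := trE j.
rewrite -(ler_pM2l Q0') divff ?gt_eqF// -[X in X * _]gtr0_norm// -normrM mulrBr.
move: i1 i2 j1 j2; rewrite fij -natr1 => i1 i2 j1 j2.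
by rewrite ler_norml; apply/andP; split; lra.
Qed.

(** Dividing [q] and [p] by their gcd [d >= 1] divides the error by [d] and keeps [q <= Q]. *)
Lemma dirichlet_coprime a (Q : nat) : (0 < Q)%N ->
  exists (q : nat) (p : int),
    [/\ (0 < q <= Q)%N, coprimez q p & `|q%:R * a - p%:~R| <= Q%:R^-1].
Proof.
move=> /(dirichlet_approximation a)[q [p [/andP[q0 qQ] hqp]]].
pose d := gcdz q p.
have d0 : d != 0 by rewrite gcdz_eq0 negb_and; apply/orP; left; lia.
have dq : (q%:Z %/ d)%Z * d = q by rewrite divzK ?dvdz_gcdl.
have dp : (p %/ d)%Z * d = p by rewrite divzK ?dvdz_gcdr.
have d1 : (1 <= d)%R by have : (0 <= d) by []; lia.
exists `|(q%:Z %/ d)%Z|%N, (p %/ d)%Z.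
have qd0 : 0 < (q%:Z %/ d)%Z by nia.
have qdE : `|(q%:Z %/ d)%Z|%N%:Z = (q%:Z %/ d)%Z by lia.
split.
- by apply/andP; split; nia.
- have := mulz_gcdl (q%:Z %/ d)%Z (p %/ d)%Z d; rewrite dq dp qdE /coprimez.
  by rewrite -/d; nia.
have e : q%:R * a - p%:~R =
   d%:~R * (`|(q%:Z %/ d)%Z|%N%:R * a - (p %/ d)%Z%:~R).
  rewrite -[in LHS]dp intrM -[q%:R]/(q%:Z%:~R) -{1}dq.
  by rewrite -[`|_|%N%:R]/(`|_|%N%:Z%:~R) qdE intrM; ring.
move: hqp; rewrite e normrM; apply: le_trans.
by rewrite ler_peMl// ger0_norm ?ler0z ?ler1z//; lia.
Qed.

Lemma positive_lower_bound (u : nat -> R) (N : nat) :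
  (forall k, (0 < k)%N -> 0 < u k) ->
  exists2 c : R, 0 < c & forall k, (0 < k < N)%N -> c <= u k.
Proof.
move=> u0; elim: N => [|N [c c0 hc]]; first by exists 1 => // k; rewrite ltn0 andbF.
have [->|N0] := posnP N.
  by exists 1 => // k /andP[k0]; rewrite ltnS leqNgt k0.
exists (Num.min c (u N)); first by rewrite lt_min c0 u0.
move=> k /andP[k0]; rewrite ltnS leq_eqVlt => /predU1P[->|kN]; rewrite ge_min.
  by rewrite lexx orbT.
by rewrite hc ?k0.
Qed.

(** The lower limit is the supremum of the infima over tails. It is nonnegative here, so if nonzero
    it is positive and some tail has a positive infimum. *)
Lemma limn_einf_neq0_lower_bound (u : nat -> R) : (forall k, 0 <= u k) ->
  limn_einf (fun k => (u k)%:E) != 0%E ->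
  exists2 c : R, 0 < c & exists N, forall k, (N <= k)%N -> c <= u k.
Proof.
move=> u0; rewrite limn_einf_lim.
rewrite (cvg_lim _ (@cvg_einfs_sup R _))//.
set s := ereal_sup _ => s0.
have e0 : (0 <= einfs (fun k => (u k)%:E) 0%N)%E.
  by apply: le_ereal_inf_tmp => _ [k _ <-]; rewrite lee_fin.
have : (0 < s)%E.
  rewrite lt_neqAle eq_sym s0 /=; apply: (le_trans e0).
  by apply: ereal_sup_ubound; exists 0%N.
move=> /ereal_sup_gt[_ [N _ <-]] hN.
(* The tail infimum is an extended real; in the formal case [+oo] any positive constant serves. *)
have [c c0 hc] : exists2 c : R, 0 < c & (c%:E <= einfs (fun k => (u k)%:E) N)%E.
  case: (einfs _ N) hN => [r|_|//]; last by exists 1; rewrite ?leey.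
  by rewrite lte_fin => r0; exists r.
exists c => //; exists N => k Nk; rewrite -lee_fin; apply: (le_trans hc).
by apply: ereal_inf_lbound; exists k.
Qed.

(** An exponent above the supremum has a nonzero lower limit, which bounds all large [k]; the
    finitely many remaining [k] are handled by irrationality. *)
Lemma dioph_type_lower_bound a (g : R) : irrational a ->
  0 <= g -> (dioph_type a < g%:E)%E ->
  exists2 c : R, 0 < c &
    forall k, (0 < k)%N -> c <= k%:R `^ g * dist_int (k%:R * a).
Proof.
move=> airr g0 ag.
pose u (k : nat) := k%:R `^ g * dist_int (k%:R * a).
have u0 k : 0 <= u k by rewrite mulr_ge0 ?powR_ge0 ?dist_int_ge0.
have [|c1 c10 [N hN]] := limn_einf_neq0_lower_bound u u0.
  apply/negP => /eqP ug; move: ag; rewrite ltNge => /negP; apply.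
  by apply: ereal_sup_ubound; exists g.
have [|c2 c20 hc2] := positive_lower_bound u N.
  by move=> k k0; rewrite mulr_gt0 ?powR_gt0 ?ltr0n// dist_int_irrational_gt0.
exists (Num.min c1 c2) => [|k k0]; first by rewrite lt_min c10.
have [Nk|kN] := leqP N k; rewrite ge_min.
  by rewrite hN.
by rewrite hc2 ?orbT// k0.
Qed.

(** A negative real supremum would force the set of nonnegative exponents to be empty, and its
    supremum would then be [-oo]. On infinite values [fine] is 0. *)
Lemma fine_dioph_type_ge0 a : 0 <= fine (dioph_type a).
Proof.
have type_ge y : [set gamma%:E | gamma in [set gamma : R | 0 <= gamma /\
    limn_einf (fun k : nat => (k%:R `^ gamma * dist_int (k%:R * a))%:E) = 0%E]]
    y -> (0 <= y <= dioph_type a)%E.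
  move=> Sy; rewrite (ereal_sup_ubound Sy) andbT.
  by case: Sy => g [g0 _] <-; rewrite lee_fin.
case E : (dioph_type a) type_ge => [r| |]//= type_ge.
rewrite leNgt; apply/negP => r0.
suff : dioph_type a = -oo%E by rewrite E.
rewrite /dioph_type (_ : [set _ | _ in _] = set0) ?ereal_sup0//.
apply/seteqP; split => // y /type_ge/andP[y0 yr].
by have := le_trans y0 yr; rewrite lee_fin leNgt r0.
Qed.

End diophantine_approximation.

(** * Borel measurability of rotations and Lipschitz functions *)

Section circle_measurability.
Context {R : realType}.

Lemma open_measurable_circle (U : set (circle R)) : open U -> measurable U.
Proof. exact: sub_sigma_algebra. Qed.

Lemma measurable_rotation a : measurable_fun setT (rotation a : circle R -> _).
Proof.
have cont : continuous (rotation a : circle R -> circle R).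
  apply/quotient_continuous => x.
  rewrite (_ : _ \o _ = to_circle \o (fun x => x + a)); last first.
    by apply/funext => y /=; rewrite /rotation to_circleD.
  apply: continuous_comp; last exact: pi_continuous.
  by apply: cvgD; [exact: cvg_id|exact: cvg_cst].
apply: (measurability (@open (circle R))) => // _ [U oU <-]; rewrite setTI.
by apply: open_measurable_circle; move/continuousP : cont; apply.
Qed.

Lemma lipschitz_circle_measurable (g : circle R -> R) (L : R) :
  (forall x y, `|g x - g y| <= L * circle_dist x y) -> measurable_fun setT g.
Proof.
move=> gL.
(* The constant [|L| + 1] is positive, so that [e] can be divided by it. *)
have L1 : forall x y, `|g x - g y| <= (`|L| + 1) * circle_dist x y.
  move=> x y; apply: (le_trans (gL x y)); apply: ler_wpM2r.
    exact: circle_dist_ge0.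
  by rewrite (le_trans (ler_norm _))// lerDl.
have L10 : 0 < `|L| + 1 by rewrite ltr_wpDl.
have cont : continuous g.
  apply/quotient_continuous => x /=; apply/cvgrPdist_le => e e0.
  near=> y; apply: (le_trans (L1 _ _)).
  rewrite -ler_pdivlMl//.
  have := @circle_dist_to_circle_le R 0 x y; rewrite !add0r => /le_trans; apply.
  near: y; apply/nbhs_ballP; exists ((`|L| + 1)^-1 * e) => /=.
    by rewrite mulr_gt0 ?invr_gt0.
  by move=> y; rewrite /ball/= => /ltW.
apply: (measurability _ (RGenOpens.measurableE R)).
move=> _ [_ [a [b ->] <-]]; rewrite setTI; apply: open_measurable_circle.
move/continuousP : cont; apply; exact: interval_open.
Unshelve. all: by end_near.
Qed.

End circle_measurability.

(** * Rotation invariance of Lebesgue measure on the circle *)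

Section circle_lebesgue_invariance.
Context {R : realType}.
Implicit Types (a b c : R).

Let measurable_addr_const c :
  measurable_fun [set: measurableTypeR R] (fun x => x + c : measurableTypeR R).
Proof. exact: measurable_funD. Qed.

(** The image of Lebesgue measure under a translation gives half-open intervals their length, hence
    is Lebesgue measure by uniqueness. *)
Lemma lebesgue_measure_translation c (A : set (measurableTypeR R)) :
  measurable A ->
  @lebesgue_measure R ((fun x => x + c) @^-1` A) = @lebesgue_measure R A.
Proof.
move=> mA; symmetry.
pose tr : measurableTypeR R -> measurableTypeR R := fun x => x + c.
have mtr : measurable_fun setT tr by exact: measurable_addr_const.
pose mtrM := isMeasurableFun.Build _ _ _ _ tr mtr.
pose TR : {mfun _ >-> _} := HB.pack tr mtrM.
rewrite -[RHS]/(pushforward lebesgue_measure TR A).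
apply: lebesgue_measure_unique mA => /=.
move=> _ [[x y]] _ <-; rewrite /pushforward/=.
rewrite (_ : _ @^-1` _ = `]x - c, y - c]%classic); last first.
  by apply/seteqP; split=> z /=; rewrite !in_itv/= ltrBlDr lerBrDr.
by rewrite !lebesgue_measure_itv/= !lte_fin ltrD2r -!EFinB opprB addrA subrK.
Qed.

(** The uniform law lives on [[0, 1]]; dropping the null endpoint gives a fundamental domain that
    can be cut and translated without overlap. *)
Lemma circle_lebE (A : set (circle R)) : measurable A ->
  circle_leb R A = lebesgue_measure (to_circle @^-1` A `&` `[0, 1[%classic).
Proof.
move=> mA; rewrite /circle_leb /distribution /pushforward /uniform_prob.
have mP : measurable (to_circle @^-1` A).
  by rewrite -[X in measurable X]setTI; exact: measurable_to_circle.
transitivity (\int[lebesgue_measure]_(x in to_circle @^-1` A)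
  (uniform_pdf 0 1 x)%:E)%E; first by [].
rewrite integral_uniform_pdf (eq_integral (fun=> 1%E)); last first.
  move=> x /[!inE] -[_ /=]; rewrite in_itv/= /uniform_pdf => ->.
  by rewrite subr0 invr1.
rewrite integral_cst/= ?mul1e; last exact: measurableI.
rewrite (_ : `[0, 1]%classic = `[0, 1[ `|` [set 1]); last first.
  by rewrite setUitv1//= bnd_simp.
rewrite setIUr measureU0//; [exact: measurableI|exact: measurableI|].
apply/eqP; rewrite -measure_le0 -(lebesgue_measure_set1 (1 : R)).
by apply: le_measure => //; rewrite inE//; exact: measurableI.
Qed.

(** For [0 <= a < 1], translating by [a] turns [[0, 1[] into [[a, a + 1[]; the piece over [[1, a +
    1[] is then moved back by 1 onto [[0, a[], using the periodicity of [P]. *)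
Lemma circle_leb_rotation a : invariant_measure (rotation a) (circle_leb R).
Proof.
wlog /andP[a0 a1] : a / 0 <= a < 1.
  move=> h.
  have := Num.Theory.floor_itv a; rewrite intrD => /andP[h1 h2].
  have -> : rotation a = rotation (a - (Num.floor a)%:~R) :> (circle R -> _).
    apply/funext => x; rewrite /rotation to_circleD to_circleN to_circle_int.
    by rewrite subr0.
  by apply: h; apply/andP; split; lra.
move=> A mA; set P := to_circle @^-1` A.
have mP : measurable P.
  by rewrite -[X in measurable X]setTI; exact: measurable_to_circle.
have mRA : measurable (rotation a @^-1` A).
  by rewrite -[X in measurable X]setTI; exact: measurable_rotation.
apply: (eq_trans (circle_lebE _ mRA)); apply/esym.
apply: (eq_trans (circle_lebE _ mA)); apply/esym; rewrite -/P.
have perP (x : R) : P (x + 1) = P x.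
  by rewrite /P/= to_circleD (to_circle_int 1) addr0.
transitivity (lebesgue_measure (P `&` `[a, a + 1[%classic)).
  rewrite -[RHS](lebesgue_measure_translation a); last exact: measurableI.
  congr lebesgue_measure; apply/seteqP; split => x /=.
    rewrite !in_itv/= /rotation /P/= to_circleD => -[Px /andP[x0 x1]].
    by split=> //; apply/andP; split; lra.
  rewrite !in_itv/= /rotation /P/= to_circleD => -[Px /andP[x0 x1]].
  by split=> //; apply/andP; split; lra.
rewrite (_ : P `&` `[a, a + 1[%classic =
  (P `&` `[a, 1[%classic) `|` (P `&` `[1, a + 1[%classic)); last first.
  rewrite -setIUr; congr setI; apply/seteqP; split => x /=; rewrite !in_itv/=.
    by move=> /andP[-> ->]; have [x1|x1] := ltP x 1; [left|right].
  by case=> /andP[x0 x1]; apply/andP; split; lra.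
rewrite (_ : P `&` `[0, 1[%classic =
  (P `&` `[a, 1[%classic) `|` (P `&` `[0, a[%classic)); last first.
  rewrite -setIUr; congr setI; apply/seteqP; split => x /=; rewrite !in_itv/=.
    by move=> /andP[-> ->]; have [x1|x1] := ltP x a; [right|left].
  by case=> /andP[x0 x1]; apply/andP; split; lra.
rewrite !measureU//; try exact: measurableI; last 2 first.
- rewrite setIACA setIid (_ : _ `&` `[0, a[%classic = set0) ?setI0//.
  apply/seteqP; split => // x [] /=; rewrite !in_itv/= => /andP[x0 x1].
  by move=> /andP[x2 x3]; lra.
- rewrite setIACA setIid (_ : _ `&` `[1, a + 1[%classic = set0) ?setI0//.
  apply/seteqP; split => // x [] /=; rewrite !in_itv/= => /andP[x0 x1].
  by move=> /andP[x2 x3]; lra.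
congr (_ + _)%E.
rewrite -[LHS](lebesgue_measure_translation 1); last exact: measurableI.
congr lebesgue_measure; apply/seteqP; split => x /=; rewrite perP !in_itv/=.
  by move=> [Px /andP[x0 x1]]; split => //; apply/andP; split; lra.
by move=> [Px /andP[x0 x1]]; split => //; apply/andP; split; lra.
Qed.

End circle_lebesgue_invariance.

(** * Integrals of bounded functions and invariant measures *)

Section bounded_integrals.
Context d (T : measurableType d) (R : realType).
Implicit Types (g : T -> R) (mu : {finite_measure set T -> \bar R}).

Lemma bounded_integrable mu g (M : R) : measurable_fun setT g ->
  (forall x, `|g x| <= M) -> mu.-integrable setT (EFin \o g).
Proof.
move=> mg gM; apply: measurable_bounded_integrable => //.
  by have := fin_num_measure mu _ measurableT; rewrite ge0_fin_numE.
exists M; split; first exact: num_real.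
by move=> y My x _; exact: le_trans (gM x) (ltW My).
Qed.

(** The Hahn decomposition is not explicit, but its Jordan parts satisfy [mu1 - mu2 = p - n].
    Rewritten as [mu1 + n = mu2 + p], this is an equality of measures, against which [g] can be
    integrated. *)
Lemma charge_integral_measure_diff (mu1 mu2 : {finite_measure set T -> \bar R})
    g (M : R) : measurable_fun setT g -> (forall x, `|g x| <= M) ->
  charge_integral (measure_diff mu1 mu2) g =
  Rintegral mu1 setT g - Rintegral mu2 setT g.
Proof.
move=> mg gM; pose h := hahn_posneg (measure_diff mu1 mu2).
pose p : {finite_measure set T -> \bar R} := jordan_pos h.
pose n : {finite_measure set T -> \bar R} := jordan_neg h.
rewrite -[LHS]/(Rintegral p setT g - Rintegral n setT g).
have int mu := bounded_integrable mu g M mg gM.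
have meq A : measurable A -> (mu1 A + n A = mu2 A + p A)%E.
  move=> mA; have e : (mu1 A - mu2 A = p A - n A)%E.
    apply: (eq_trans (jordan_decomp h mA)).
    by rewrite /cadd/= cscaleN1.
  have m2 := fin_num_measure mu2 _ mA; have nf := fin_num_measure n _ mA.
  by rewrite -[mu1 A](subeK _ m2) e addeAC subeK// addeC.
have : (\int[measure_add mu1 n]_x (g x)%:E = \int[measure_add mu2 p]_x (g x)%:E)%E.
  apply: eq_measure_integral => A mA _.
  apply: (eq_trans (measure_addE mu1 n A)); rewrite meq//.
  exact: (esym (measure_addE mu2 p A)).
have mg' : measurable_fun setT (EFin \o g) by exact/measurable_EFinP.
rewrite !integral_measure_add//; try exact: int.
have fin mu := integrable_fin_num measurableT (int mu).
move=> /(congr1 fine); rewrite (fineD (fin mu1) (fin n)).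
rewrite (fineD (fin mu2) (fin p)) => e.
have {}e : Rintegral mu1 setT g + Rintegral n setT g =
    Rintegral mu2 setT g + Rintegral p setT g by exact: e.
by apply/eqP; rewrite subr_eq addrAC e addrC addKr.
Qed.

Lemma Rintegral_approx (P : probability T R) g (b e : R) :
  measurable_fun setT g -> (forall x, `|g x - b| <= e) ->
  `|Rintegral P setT g - b| <= e.
Proof.
move=> mg gb.
have ig : P.-integrable setT (EFin \o g).
  apply: (bounded_integrable P g (`|b| + e)) => // x.
  rewrite -[g x](subrK b); apply: (le_trans (ler_normD _ _)).
  by rewrite addrC lerD2l.
have P1 c : Rintegral P setT (fun=> c) = c.
  by rewrite Rintegral_cst//= probability_setT mulr1.
have ic c : P.-integrable setT (EFin \o (fun=> c)).
  by apply: (bounded_integrable P _ `|c|).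
rewrite -(P1 b) -RintegralB//.
apply: (le_trans (le_normr_Rintegral _ _)) => //.
  by apply: (bounded_integrable P _ e) => //; exact: measurable_funB.
rewrite -[leRHS](P1 e); apply: le_Rintegral => //.
apply: (bounded_integrable P _ e) => [|x]; last by rewrite normr_id.
by apply: measurableT_comp => //; exact: measurable_funB.
Qed.

Lemma Rintegral_iter (P : probability T R) (F : T -> T) g (M : R) i :
  measurable_fun setT F -> (forall A, measurable A -> P (F @^-1` A) = P A) ->
  measurable_fun setT g -> (forall x, `|g x| <= M) ->
  Rintegral P setT (g \o iter i F) = Rintegral P setT g.
Proof.
move=> mF PF; elim: i g => [//|i ih] g mg gM.
have mi : measurable_fun setT (iter i F).
  by elim: i {ih} => [|i ih]; [exact: measurable_id|exact: measurableT_comp].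
(* The induction hypothesis is applied to [g \o F], leaving a single change of variables by [F]. *)
rewrite (_ : g \o iter i.+1 F = (g \o F) \o iter i F)//.
rewrite ih => [|//|x]; [|exact: measurableT_comp|exact: gM].
rewrite /Rintegral; congr fine.
have := @integral_pushforward _ _ _ _ R F mF P setT (EFin \o g).
rewrite preimage_setT => <- //=; last 2 first.
- exact/measurable_EFinP.
- apply: (bounded_integrable P (g \o F) M) => // [|x]; last exact: gM.
  exact: measurableT_comp.
by apply: eq_measure_integral => A mA _; exact: PF.
Qed.

Lemma Rintegral_average (P : probability T R) (F : T -> T) g (M : R) n :
  measurable_fun setT F -> (forall A, measurable A -> P (F @^-1` A) = P A) ->
  measurable_fun setT g -> (forall x, `|g x| <= M) ->
  Rintegral P setT (fun x => \sum_(i < n) g (iter i F x)) =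
  n%:R * Rintegral P setT g.
Proof.
move=> mF PF mg gM.
have mi i : measurable_fun setT (iter i F).
  by elim: i => [|i ih]; [exact: measurable_id|exact: measurableT_comp].
elim: n => [|n ih].
  rewrite mul0r -[RHS](mul0r (fine (P setT))) -Rintegral_cst//.
  by apply: eq_Rintegral => x _; rewrite big_ord0.
transitivity (Rintegral P setT
    (fun x => (\sum_(i < n) g (iter i F x)) + g (iter n F x))).
  by apply: eq_Rintegral => x _; rewrite big_ord_recr.
rewrite RintegralD//.
- rewrite ih -natr1 mulrDl mul1r; congr (_ + _).
  exact: (Rintegral_iter P F g M).
- apply: (bounded_integrable P _ (n%:R * M)) => [|x].
    by apply: measurable_sum => i; exact: measurableT_comp.
  apply: (le_trans (ler_norm_sum _ _ _)).
  rewrite mulr_natl -[n in leRHS]card_ord -sumr_const.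
  by apply: ler_sum => i _; exact: gM.
- apply: (bounded_integrable P _ M) => [|x]; last exact: gM.
  exact: measurableT_comp.
Qed.

End bounded_integrals.

(** * Birkhoff sums along rotations and perturbed orbits *)

Section birkhoff_sums.
Context {R : realType}.
Variables (g : circle R -> R) (L : R).
Hypothesis L_ge0 : 0 <= L.
Hypothesis gL : forall x y, `|g x - g y| <= L * circle_dist x y.
Implicit Types (a s t : R) (x y : circle R) (q n : nat) (p : int).

Definition rotation_sum a q x := \sum_(i < q) g (x + to_circle (i%:R * a)).

(* A shift by [p / q] permutes the terms cyclically, and [1 / q] is an integer
   multiple of [p / q] modulo 1. *)
Lemma rotation_sum_periodic q p x : (0 < q)%N -> coprimez q p ->
  rotation_sum (p%:~R / q%:R) q (x + to_circle q%:R^-1) =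
  rotation_sum (p%:~R / q%:R) q x.
Proof.
move=> q0; have qn0 : q%:R != 0 :> R by rewrite pnatr_eq0 -lt0n.
set b := p%:~R / q%:R; set S := rotation_sum b q.
have step y : S (y + to_circle b) = S y.
  pose f i := g (y + to_circle (i%:R * b)).
  have -> : S (y + to_circle b) = \sum_(i < q) f i.+1.
    apply: eq_bigr => i _; congr g.
    by rewrite -addrA -to_circleD -natr1 mulrDl mul1r [b + _]addrC.
  have -> : S y = \sum_(i < q) f i by [].
  (* Adding [f 0] makes one side the sum of [f 0], ..., [f q]; the other side agrees because
     [f q = f 0], as [q * b] is the integer [p]. *)
  apply: (@addrI _ (f 0%N)).
  rewrite -(big_ord_recl q f) big_ord_recr/= addrC; congr (_ + _).
  rewrite /f mul0r to_circle0 /b mulrC divfK//.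
  by rewrite to_circle_int.
have stepn n y : S (y + to_circle (n%:R * b)) = S y.
  rewrite to_circleMn; elim: n => [|n ih]; first by rewrite addr0.
  by rewrite mulrSr addrA step.
have stepz (v : int) y : S (y + to_circle (v%:~R * b)) = S y.
  case: v => n; first exact: stepn.
  rewrite NegzE mulrNz mulNr to_circleN.
  by have := stepn n.+1 (y - to_circle (n.+1%:R * b)); rewrite subrK => ->.
rewrite /coprimez; have [u [v <-]] := Bezoutz q p.
move=> /eqP uv; rewrite -[RHS](stepz v); congr (S (_ + _)).
apply/to_circle_eq; apply/intrP; exists u.
apply: (mulfI qn0); rewrite mulrBr divff// /b.
have uvR : u%:~R * q%:R + v%:~R * p%:~R = 1 :> R.
  by have := congr1 (fun z : int => z%:~R : R) uv; rewrite intrD !intrM.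
apply/eqP; rewrite mulrCA [q%:R * (_ / _)]mulrC divfK// subr_eq.
by rewrite -[X in X == _]uvR [q%:R * _]mulrC.
Qed.

(** Replacing [a] by [p / q] costs [L] at [x] and [L] at [y]; the [1 / q]-periodic sum itself
    oscillates by at most [L]. *)
Lemma rotation_sum_osc a q p Q x y : (0 < q <= Q)%N -> coprimez q p ->
  `|q%:R * a - p%:~R| <= Q%:R^-1 ->
  `|rotation_sum a q x - rotation_sum a q y| <= 3 * L.
Proof.
move=> /andP[q0 qQ] qp qap.
have qgt0 : 0 < q%:R :> R by rewrite ltr0n.
have qn0 : q%:R != 0 :> R by rewrite gt_eqF.
set b : R := p%:~R / q%:R.
have close z : `|rotation_sum a q z - rotation_sum b q z| <= L.
  rewrite /rotation_sum -sumrB.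
  apply: (le_trans (ler_norm_sum _ _ _)).
  apply: (@le_trans _ _ (\sum_(i < q) L * q%:R^-1)); last first.
    by rewrite sumr_const card_ord -[leLHS]mulr_natr divfK.
  apply: ler_sum => i _; apply: (le_trans (gL _ _)); apply: ler_wpM2l => //.
  apply: (le_trans (circle_dist_to_circle_le _ _ _)).
  rewrite -mulrBr normrM ger0_norm//.
  (* Since [i < q], the displacement is at most [q * |a - b| = |q * a - p| <= 1 / Q <= 1 / q]. *)
  apply: (@le_trans _ _ (q%:R * `|a - b|)).
    by apply: ler_wpM2r => //; rewrite ler_nat ltnW.
  rewrite -{1}(gtr0_norm qgt0) -normrM mulrBr /b [q%:R * (_ / _)]mulrC divfK//.
  by apply: (le_trans qap); rewrite lef_pV2 ?posrE ?ler_nat// ltr0n (leq_trans q0).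
have per k z : rotation_sum b q (z + to_circle (k%:R / q%:R)) = rotation_sum b q z.
  rewrite to_circleMn; elim: k => [|k ih]; first by rewrite addr0.
  by rewrite mulrSr addrA rotation_sum_periodic.
have oscb : `|rotation_sum b q x - rotation_sum b q y| <= L.
  pose t := repr (y - x) - (Num.floor (repr (y - x)))%:~R.
  have t01 : 0 <= t < 1.
    have := Num.Theory.floor_itv (repr (y - x)).
    by rewrite intrD /t => /andP[h1 h2]; apply/andP; split; lra.
  have yE : y = x + to_circle t.
    rewrite /t to_circleD to_circleN to_circle_int subr0 to_circle_repr.
    by rewrite addrC subrK.
  have /andP[t0 _] := t01.
  have /andP[k1 k2] := Num.Theory.truncn_itv (mulr_ge0 (ltW qgt0) t0).
  (* With [k] the integer part of [q * t], the point [x + k / q] lies within [1 / q] of [y] and has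
     the same sum as [x]. *)
  set k := Num.truncn _ in k1 k2.
  rewrite -(per k x) /rotation_sum -sumrB.
  apply: (le_trans (ler_norm_sum _ _ _)).
  apply: (@le_trans _ _ (\sum_(i < q) L * q%:R^-1)); last first.
    by rewrite sumr_const card_ord -[leLHS]mulr_natr divfK.
  apply: ler_sum => i _; apply: (le_trans (gL _ _)); apply: ler_wpM2l => //.
  rewrite circle_distDr yE; apply: (le_trans (circle_dist_to_circle_le _ _ _)).
  rewrite distrC -(ler_pM2l qgt0) divff// -{1}(gtr0_norm qgt0) -normrM mulrBr.
  rewrite [q%:R * (_ / _)]mulrC divfK//.
  by move: k2; rewrite -natr1 ler_norml => k2; apply/andP; split; lra.
have := close x; have := close y; move: oscb.
rewrite !ler_norml => /andP[? ?] /andP[? ?] /andP[? ?].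
by apply/andP; split; lra.
Qed.

(** A rotation is an isometry, so earlier errors are carried along unamplified and each step adds at
    most [delta]. *)
Lemma perturbed_orbit_close a (F : circle R -> circle R) (delta : R) n x :
  (forall y, circle_dist (rotation a y) (F y) <= delta) ->
  circle_dist (x + to_circle (n%:R * a)) (iter n F x) <= n%:R * delta.
Proof.
move=> aF; elim: n => [|n ih].
  by rewrite !mul0r to_circle0 addr0 circle_distxx.
rewrite iterS; apply: (le_trans (circle_dist_triangle (rotation a (iter n F x)) _ _)).
rewrite -natr1 !mulrDl !mul1r to_circleD addrA.
by apply: lerD => //; rewrite circle_distDr.
Qed.

(** The sum at 0 is a reference value independent of [P] and [F], through which the integrals for
    two invariant measures can be compared. *)
Lemma invariant_integral_close a (F : circle R -> circle R) (delta : R) q p Q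
    (P : probability (circle R) R) (M : R) :
  (0 < q <= Q)%N -> coprimez q p -> `|q%:R * a - p%:~R| <= Q%:R^-1 ->
  measurable_fun setT F -> invariant_measure F P -> 
  (forall y, circle_dist (rotation a y) (F y) <= delta) ->
  (forall x, `|g x| <= M) ->
  `|q%:R * Rintegral P setT g - rotation_sum a q 0|
     <= 3 * L + q%:R ^+ 2 * L * delta.
Proof.
move=> qQ qp qap mF PF aF gM.
have mg : measurable_fun setT g by exact: lipschitz_circle_measurable gL.
have d0 : 0 <= delta by exact: le_trans (circle_dist_ge0 _ _) (aF 0).
rewrite -(Rintegral_average _ _ _ P F g M q)//.
have mi i : measurable_fun setT (iter i F).
  by elim: i => [|i ih]; [exact: measurable_id|exact: measurableT_comp].
apply: Rintegral_approx => [|x].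
  by apply: measurable_sum => i; exact: measurableT_comp.
apply: (le_trans (ler_distD (rotation_sum a q x) _ _)).
rewrite addrC; apply: lerD; first exact: rotation_sum_osc qp qap.
rewrite distrC /rotation_sum -sumrB.
apply: (le_trans (ler_norm_sum _ _ _)).
(* The drift [i * delta] is bounded by [q * delta] in each of the [q] terms. *)
apply: (@le_trans _ _ (\sum_(i < q) L * (q%:R * delta))); last first.
  by rewrite sumr_const card_ord -[leLHS]mulr_natr le_eqVlt; apply/orP; left; apply/eqP; ring.
apply: ler_sum => i _; apply: (le_trans (gL _ _)); apply: ler_wpM2l => //.
apply: (le_trans (perturbed_orbit_close _ _ _ _ _ aF)).
by apply: ler_wpM2r => //; rewrite ler_nat ltnW.
Qed.

End birkhoff_sums.

(** * The dual norm at a fixed denominator *)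

Section norm_W_bound.
Context {R : realType}.

(* The infimum defining [lip_const] is not known to be attained: hence 2. *)
Lemma lip_const_le1 (g : circle R -> R) : (lip_const g <= 1)%E ->
  forall x y, `|g x - g y| <= 2 * circle_dist x y.
Proof.
move=> g1; have : (lip_const g < 2%:E)%E.
  by apply: (le_lt_trans g1); rewrite lte_fin; lra.
move=> /ereal_inf_lt[_ [K [K0 gK] <-]]; rewrite lte_fin => K2 x y.
by apply: (le_trans (gK x y)); rewrite ler_wpM2r ?circle_dist_ge0// ltW.
Qed.

Lemma sup_norm_le1 (g : circle R -> R) : (sup_norm g <= 1)%E ->
  forall x, `|g x| <= 1.
Proof.
move=> g1 x; rewrite -lee_fin; apply: le_trans g1.
by apply: ereal_sup_ubound; exists x.
Qed.

(** With [L = 2], the comparison with the sum at 0 costs [6 + 2 q^2 delta] for [P], and 6 for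
    Lebesgue measure, taken with the exact rotation and error 0. Dividing the total by [q] gives the
    bound. *)
Lemma norm_W_bound a (F : circle R -> circle R) (delta : R) (q : nat) (p : int)
    (Q : nat) (P : probability (circle R) R) :
  (0 < q <= Q)%N -> coprimez q p -> `|q%:R * a - p%:~R| <= Q%:R^-1 ->
  measurable_fun setT F -> invariant_measure F P ->
  (forall y, circle_dist (rotation a y) (F y) <= delta) ->
  `|norm_W (measure_diff (circle_leb R) P)| <= 12 / q%:R + 2 * q%:R * delta.
Proof.
move=> qQ qp qap mF PF aF.
set B := 12 / _ + _.
have q0 : 0 < q%:R :> R by rewrite ltr0n; case/andP: qQ.
have bound g : (lip_const g <= 1)%E -> (sup_norm g <= 1)%E ->
    `|charge_integral (measure_diff (circle_leb R) P) g| <= B.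
  move=> /lip_const_le1 gL /sup_norm_le1 g1.
  have mg : measurable_fun setT g by exact: lipschitz_circle_measurable gL.
  rewrite (charge_integral_measure_diff _ _ _ _ _ _ 1)//.
  have two0 : 0 <= 2 :> R by [].
  have hP := invariant_integral_close g 2 two0 gL a F delta q p Q P 1 qQ qp qap
    mF PF aF g1.
  have aa y : circle_dist (rotation a y) (rotation a y) <= 0.
    by rewrite circle_distxx.
  have hm := invariant_integral_close g 2 two0 gL a (rotation a) 0 q p Q
    (circle_leb R) 1 qQ qp qap (measurable_rotation a) (circle_leb_rotation a)
    aa g1.
  rewrite -(ler_pM2l q0) -{1}(gtr0_norm q0) -normrM mulrBr.
  have -> : q%:R * B = 12 + q%:R ^+ 2 * 2 * delta.
    by rewrite /B; field; rewrite gt_eqF.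
  move: hP hm; rewrite mulr0 addr0 !ler_norml => /andP[? ?] /andP[? ?].
  by apply/andP; split; lra.
rewrite /norm_W.
set E := [set _ | _ in _].
have E0 : E (`|charge_integral (measure_diff (circle_leb R) P) (fun=> 0)|).
  exists (fun=> 0) => //; split.
    apply: ereal_inf_lbound; exists 1 => //; split => // x y.
    by rewrite subrr normr0 mul1r circle_dist_ge0.
  by apply: ge_ereal_sup => _ [x _ <-]; rewrite normr0 lee_fin.
have EB : ubound E B by move=> _ [g [g1 g2] <-]; exact: bound.
rewrite ger0_norm; first by apply: ge_sup => //; eexists; exact: E0.
by apply: le_trans (ub_le_sup _ E0); [exact: normr_ge0|exists B].
Qed.

End norm_W_bound.

(** * Choice of the scale and conclusion *)

(* With [l = 1 / (gamma + 1)], the exponent [l^-1 - 1] is [gamma]. *)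
Lemma optimal_scale {R : realType} (c l : R) : 0 < c -> 0 < l < 1 ->
  exists K : R, forall delta : R, 0 < delta <= 1 ->
    exists2 Q : nat, (0 < Q)%N & forall q : nat, (0 < q <= Q)%N ->
      c * Q%:R <= q%:R `^ (l^-1 - 1) ->
      12 / q%:R + 2 * q%:R * delta <= K * delta `^ l.
Proof.
move=> c0 /andP[l0 l1].
(* This is [1 / gamma], the power that turns the lower bound on [q ^ gamma] into one on [q]. *)
pose s := l / (1 - l).
have s0 : 0 < s by rewrite divr_gt0// subr_gt0.
have gs : (l^-1 - 1) * s = 1 by rewrite /s; field; apply/andP; split; rewrite ?gt_eqF ?subr_gt0//.
have ls : (l - 1) * s = - l by rewrite /s; field; rewrite gt_eqF ?subr_gt0.
exists (12 * (c / 2) `^ (- s) + 2) => d /andP[d0 d1].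
(* The scale [Q] is the integer part of [d ^ (l - 1)]; [d <= 1] ensures that it is positive. *)
have D1 : 1 <= d `^ (l - 1).
  by rewrite -[leLHS](powRr0 d) ger_powR ?d0//; lra.
have D0 : 0 <= d `^ (l - 1) by exact: le_trans D1.
have /andP[Q1 Q2] := Num.Theory.truncn_itv D0.
set Q := Num.truncn _ in Q1 Q2.
have Q0 : (0 < Q)%N by rewrite Num.Theory.truncn_gt0.
exists Q => // q /andP[q0 qQ] cq.
have q0R : 0 < q%:R :> R by rewrite ltr0n.
rewrite [leRHS]mulrDl; apply: lerD; last first.
  rewrite -mulrA ler_pM2l//.
  rewrite -(mulr_powRB1 (ltW d0) l0) [q%:R * d]mulrC.
  by rewrite ler_pM2l//; apply: le_trans Q1; rewrite ler_nat.
rewrite -mulrA ler_pM2l//.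
(* Rounding down loses at most a factor 2, whence [c / 2] in the constant. *)
have Qd : d `^ (l - 1) <= 2 * Q%:R.
  apply: (le_trans (ltW Q2)); rewrite -natr1.
  have : 1 <= Q%:R :> R by rewrite ler1n.
  lra.
have : (c / 2 * d `^ (l - 1)) `^ s <= (q%:R `^ (l^-1 - 1)) `^ s.
  apply: ge0_ler_powR; rewrite ?nnegrE ?powR_ge0 ?(ltW s0)//.
    by rewrite mulr_ge0// ltW// divr_gt0.
  apply: le_trans cq; have := ler_wpM2l (ltW c0) Qd; lra.
rewrite -powRrM gs powRr1 ?ler0n// powRM//; last by rewrite ltW// divr_gt0.
rewrite -powRrM ls !powRN => h.
rewrite -[leRHS]invrK lef_pV2 ?posrE// ?invr_gt0 ?mulr_gt0 ?invr_gt0 ?powR_gt0 ?divr_gt0//.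
by rewrite invfM invrK.
Qed.

Theorem theorem14 (R : realType) (alpha : R)
  (alpha_irr : irrational alpha)
  (alpha_type : (dioph_type alpha < +oo)%E)
  (deltabar : R) (deltabar_gt0 : 0 < deltabar)
  (T : R -> circle R -> circle R)
  (T_meas : forall delta : R, 0 <= delta <= deltabar ->
     measurable_fun [set: circle R] (T delta))
  (T_close : forall delta : R, 0 <= delta <= deltabar ->
     sup [set circle_dist (rotation alpha x) (T delta x) | x in [set: circle R]]
       <= delta)
  (mu : R -> probability (circle R) R)
  (mu_inv : forall delta : R, 0 <= delta <= deltabar ->
     invariant_measure (T delta) (mu delta))
  (l : R) (l_lt : l < (fine (dioph_type alpha) + 1)^-1) :
  (fun delta : R => norm_W (measure_diff (circle_leb R) (mu delta)))
    =O_ (0^'+) (fun delta : R => delta `^ l).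
Proof.
set t := fine (dioph_type alpha) in l_lt *.
have t0 : 0 <= t by exact: fine_dioph_type_ge0.
(* Since [l] may be nonpositive, it is raised to an exponent [m] in []0, 1[] still below the
   threshold; [d ^ m <= d ^ l] for [d <= 1]. *)
have [m [m01 lm mt]] : exists m : R, [/\ 0 < m < 1, l <= m & m < (t + 1)^-1].
  have t1 : 0 < t + 1 by lra.
  exists (Num.max l ((t + 1)^-1 / 2)).
  have h0 : 0 < (t + 1)^-1 by rewrite invr_gt0.
  have h1 : (t + 1)^-1 <= 1 by rewrite invf_le1//; lra.
  have h2 : Num.max l ((t + 1)^-1 / 2) < (t + 1)^-1 by rewrite gt_max l_lt; lra.
  split => //; last by rewrite le_max lexx.
  by rewrite (lt_le_trans h2 h1) andbT lt_max; apply/orP; right; lra.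
have /andP[m0 m1] := m01.
have tm : t < m^-1 - 1.
  rewrite ltrBrDr -[ltLHS]invrK ltf_pV2 ?posrE// invr_gt0; lra.
have type_m : (dioph_type alpha < (m^-1 - 1)%:E)%E.
  move: alpha_type tm; rewrite /t; case: (dioph_type alpha) => [r _|//|_ _].
    by rewrite lte_fin.
  exact: ltNyr.
have [c c0 hc] := dioph_type_lower_bound alpha _ alpha_irr
  (ltW (le_lt_trans t0 tm)) type_m.
have [K hK] := optimal_scale c m c0 m01.
apply/eqO_exP; exists (`|K| + 1); first by rewrite ltr_wpDl.
near=> d.
have d0 : 0 < d by near: d; exact: nbhs_right_gt.
have d1 : d <= 1 by near: d; exact: nbhs_right_le.
have db : 0 <= d <= deltabar.
  by rewrite ltW//=; near: d; exact: nbhs_right_le.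
have [|Q Q0 hQ] := hK d; first by rewrite d0.
have [q [p [qQ qp qap]]] := dirichlet_coprime alpha Q Q0.
have q0 : (0 < q)%N by case/andP: qQ.
(* Circle distances are at most 1, so the real [sup] is a genuine upper bound. *)
have close y : circle_dist (rotation alpha y) (T d y) <= d.
  apply: le_trans (T_close d db); apply: ub_le_sup; last by exists y.
  by exists 1 => _ [z _ <-]; exact: circle_dist_le1.
apply: (le_trans (norm_W_bound alpha (T d) d q p Q (mu d) qQ qp qap
  (T_meas d db) (mu_inv d db) close)).
apply: (@le_trans _ _ (K * d `^ m)).
  (* With [gamma = 1 / m - 1], the Diophantine bound gives [c <= q ^ gamma * |q * alpha - p| <= q ^
     gamma / Q]. *)
  apply: hQ => //; rewrite -ler_pdivlMr ?ltr0n//.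
  apply: (le_trans (hc q q0)); apply: ler_wpM2l; first exact: powR_ge0.
  exact: le_trans (dist_int_le _ p) qap.
rewrite [`|d `^ l|]ger0_norm ?powR_ge0//.
apply: (@le_trans _ _ ((`|K| + 1) * d `^ m)).
  by apply: ler_wpM2r; [exact: powR_ge0|rewrite (le_trans (ler_norm K))// lerDl].
apply: ler_wpM2l; first by rewrite addr_ge0.
by rewrite ger_powR// d0.
Unshelve. all: by end_near.
Qed.
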